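(* Let $\mathcal{A}\in\mathbb{R}^{I_1\times\cdots\times I_D}$ be a tensor given by a tensor train (TT) in site-$K$-mixed-canonical form, let $K\ge2$ be the order of the isometries, let $N$ be the total number of isometries in the desired multi-layer MERA, and let $\epsilon$ be a prescribed upper bound on the relative error. If the MERACLE algorithm described in the context is run with tolerance $\delta=\epsilon\|\mathcal{A}\|_F/\sqrt{N}$ for each of the truncated SVDs that produce the isometries, then the tensor $\mathcal{B}$ represented by the computed MERA (disentanglers, isometries and top tensor) satisfies $$\|\mathcal{A}-\mathcal{B}\|_F\le\epsilon\,\|\mathcal{A}\|_F .$$
   Context: All tensors are real; $\|\cdot\|_F^2$ is the sum of squares of all entries. Multi-indices are linearized with the first index running fastest, and reshapings keep this linear order. TT. A TT of a tensor $\mathcal{A}$ is a set of cores $\mathcal{A}^{(d)}\in\mathbb{R}^{R_d\times I_d\times R_{d+1}}$, $1\le d\le D$, $R_1=R_{D+1}=1$, with $\mathcal{A}(i_1,\ldots,i_D)=\sum_{r_1,\ldots,r_D}\mathcal{A}^{(1)}(r_1,i_1,r_2)\cdots\mathcal{A}^{(D)}(r_D,i_D,r_1)$. A core is left-orthogonal if its $R_dI_d\times R_{d+1}$ reshaping has orthonormal columns and right-orthogonal if its $R_d\times I_dR_{d+1}$ reshaping has orthonormal rows. The TT is in site-$d$-mixed-canonical form if all cores before the $d$th are left-orthogonal and all cores after the $d$th are right-orthogonal. A supercore is the 3-way tensor obtained by contracting several consecutive TT-cores over their connecting auxiliary indices and merging their free indices into one multi-index; replacing consecutive cores by a supercore gives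 a TT of the correspondingly reshaped tensor. MERA. A disentangler is a 4-way tensor of size $I\times I'\times I\times I'$ that reshapes to an orthogonal $II'\times II'$ matrix; it acts on two neighbouring indices of dimensions $I,I'$. An isometry of order $K$ is a tensor of size $J_1\times\cdots\times J_K\times S$ that reshapes to a $J_1\cdots J_K\times S$ matrix with orthonormal columns; its transpose maps $K$ consecutive indices to one index of dimension $S$. A MERA layer applied to a tensor first applies disentanglers to chosen disjoint pairs of neighbouring indices (pairs that bridge adjacent isometry groups, e.g. the pairs $(jK,jK+1)$), and then applies the transposes of isometries to the consecutive disjoint groups of $K$ indices, giving a tensor with fewer indices. A MERA consists of finitely many layers and a top tensor whose indices are the output indices of the isometries of the last layer. The tensor represented by the MERA is obtained from the top tensor by applying, from the last layer to the first, the isometry matrices (mapping each output index back to its $K$ input indices) and then the transposes of the disentangler matrices. TT-to-Tucker sweep. Given a TT, possibly of supercores, for each (super)core to be processed in turn the TT is in mixed-canonical form at that (super)core. Let $\mathbf{A}_d$ be its reshaping to a matrix whose rows are indexed by its free index and whose columns are indexed by its two auxiliary indices. Compute an SVD: a full SVD (square orthogonal left factor $\mathbf{U}_d$, no truncation), or a truncated one, $\mathrm{SVD}_\delta$, with $\mathbf{A}_d=\mathbf{U}_d\mathbf{S}\mathbf{V}^T+\mathbf{E}$, $\|\mathbf{E}\|_F\le\delta$, retaining the largest singular values (at least one). Record $\mathbf{U}_d$, replace the (super)core by $\mathbf{U}_d^T\mathbf{A}_d$ reshaped to a 3-way core, and move the canonical site to the next (super)core by QR decomposition. The resulting TT represents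 the (partial) Tucker core. MERACLE. Set $\delta=\epsilon\|\mathcal{A}\|_F/\sqrt{N}$. For each MERA layer: (1) Form supercores of the current TT at the desired disentangler locations (pairs of neighbouring cores). (2) Apply the TT-to-Tucker sweep with full SVDs to these supercores; the disentanglers are the reshapings of the transposes $\mathbf{U}_d^T$ of the resulting square orthogonal factors. (3) Split the supercores of the partial Tucker core back into individual TT-cores by SVDs without error. (4) Form new supercores from the consecutive groups of $K$ cores on which the isometries act. (5) Apply the TT-to-Tucker sweep with $\mathrm{SVD}_\delta$ to all these supercores; the isometries are the reshapings of the resulting factors $\mathbf{U}_d$, and the resulting Tucker core in TT form is the input of the next layer (after exact SVD splitting where needed). After the last layer the remaining Tucker core is retained as the top tensor. *)

(* Defs.v *)
From HB Require Import structures.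
From mathcomp Require Import all_boot all_order all_algebra.
Set Implicit Arguments. Unset Strict Implicit. Unset Printing Implicit Defensive.
Import Order.TTheory GRing.Theory Num.Theory.
Local Open Scope ring_scope.

(* A list [:: n1; ...; nD] of nats is a list of dimensions.  Positions in such
   lists are counted from 0.                                                 *)

Fixpoint midx (d : seq nat) : finType :=
  if d is n :: d' then ('I_n * midx d')%type else unit.

Fixpoint prodn (d : seq nat) : nat :=
  if d is n :: d' then (n * prodn d')%N else 1%N.

Lemma fuse_subproof n m (i : 'I_n) (j : 'I_m) : (i + n * j < n * m)%N.
Proof.
apply: (@leq_trans (n * j.+1)%N); first by rewrite mulnS ltn_add2r.
by rewrite leq_mul2l ltn_ord orbT.
Qed.

Lemma unfuse_subproof1 n m (k : 'I_(n * m)) : (k %% n < n)%N.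
Proof. by case: n k => [|n] k; [case: k | rewrite ltn_mod]. Qed.

Lemma unfuse_subproof2 n m (k : 'I_(n * m)) : (k %/ n < m)%N.
Proof.
case: n k => [|n] k; first by case: k.
by rewrite ltn_divLR // [X in (_ < X)%N]mulnC.
Qed.

(* The first index runs fastest. *)
Definition fuse n m (i : 'I_n) (j : 'I_m) : 'I_(n * m) :=
  Ordinal (fuse_subproof i j).

Definition unfuse n m (k : 'I_(n * m)) : 'I_n * 'I_m :=
  (Ordinal (unfuse_subproof1 k), Ordinal (unfuse_subproof2 k)).

Fixpoint lin (b : seq nat) : midx b -> 'I_(prodn b) :=
  if b is n :: b' then fun i : midx (n :: b') => fuse i.1 (lin i.2)
  else fun=> ord0.

Fixpoint unlin (b : seq nat) : 'I_(prodn b) -> midx b :=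
  if b is n :: b' then
    fun k : 'I_(prodn (n :: b')) => ((unfuse k).1, unlin (unfuse k).2)
  else fun=> tt.

Fixpoint icat (b d : seq nat) : midx b -> midx d -> midx (b ++ d) :=
  if b is n :: b' then
    fun (i : midx (n :: b')) j => (i.1, icat i.2 j) : midx ((n :: b') ++ d)
  else fun=> id.

Fixpoint isplit (b d : seq nat) : midx (b ++ d) -> midx b * midx d :=
  if b is n :: b' then
    fun i : midx ((n :: b') ++ d) =>
      let p := isplit i.2 in ((i.1, p.1) : midx (n :: b'), p.2)
  else fun i => (tt, i).

(* [blocking d e]: the dimension list d is cut into consecutive blocks and the
   indices of each block are merged into one multi-index, which gives the
   dimension list e. *)
Inductive blocking : seq nat -> seq nat -> Type :=
| BNil : blocking [::] [::]
| BCons b d e : blocking d e -> blocking (b ++ d) (prodn b :: e).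

Fixpoint shape d e (B : blocking d e) : seq nat :=
  if B is BCons b _ _ B' then size b :: shape B' else [::].

Fixpoint bidx d e (B : blocking d e) : midx d -> midx e :=
  match B in blocking d e return midx d -> midx e with
  | BNil => id
  | BCons b d e B' => fun i =>
      let p := isplit i in ((lin p.1, bidx B' p.2) : midx (prodn b :: e))
  end.

Fixpoint bunidx d e (B : blocking d e) : midx e -> midx d :=
  match B in blocking d e return midx e -> midx d with
  | BNil => id
  | BCons b d e B' => fun i : midx (prodn b :: e) =>
      icat (unlin i.1) (bunidx B' i.2)
  end.

Section Tensors.
Context {R : rcfType}.

Definition frobenius (T : finType) (f : T -> R) : R :=
  Num.sqrt (\sum_x f x ^+ 2).

Definition mxnorm m n (A : 'M[R]_(m, n)) : R :=
  frobenius (fun x : 'I_m * 'I_n => A x.1 x.2).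

Definition tensor (d : seq nat) := {ffun midx d -> R}.

Definition tnorm d (T : tensor d) : R := frobenius T.

Definition treshape d e (B : blocking d e) (T : tensor d) : tensor e :=
  [ffun i => T (bunidx B i)].

Definition tunreshape d e (B : blocking d e) (T : tensor e) : tensor d :=
  [ffun i => T (bidx B i)].

Definition orthonormal_cols m n (U : 'M[R]_(m, n)) : Prop := U^T *m U = 1%:M.
Definition orthonormal_rows m n (U : 'M[R]_(m, n)) : Prop := U *m U^T = 1%:M.

Definition svd m n (A : 'M[R]_(m, n))
    (U : 'M[R]_m) (S : 'M[R]_(m, n)) (V : 'M[R]_n) : Prop :=
  [/\ orthonormal_cols U, orthonormal_cols V,
      [/\ is_diag_mx S, forall i j, 0 <= S i j
        & forall (i i' : 'I_m) (j j' : 'I_n),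
            i = j :> nat -> i' = j' :> nat -> (i <= i')%N -> S i' j' <= S i j]
    & A = U *m S *m V^T].

Inductive full_svd m n (A : 'M[R]_(m, n)) : forall k, 'M[R]_(m, k) -> Prop :=
| FullSVD U S V : svd A U S V -> @full_svd m n A m U.

(* SVD_delta: the k >= 1 leading singular triplets of an SVD are kept, and the
   discarded part has norm at most delta.  Multiplying by [pid_mx k] selects
   the first k columns (on the right) or rows (on the left). *)
Definition svd_trunc (delta : R) m n k (A : 'M[R]_(m, n))
    (U : 'M[R]_(m, k)) (S : 'M[R]_k) (V : 'M[R]_(n, k)) : Prop :=
  exists U' S' V',
    [/\ svd A U' S' V', (0 < k <= minn m n)%N,
        [/\ U = U' *m pid_mx k, S = pid_mx k *m S' *m pid_mx k
          & V = V' *m pid_mx k]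
      & mxnorm (A - U *m S *m V^T) <= delta].

Definition trunc_svd (delta : R) m n (A : 'M[R]_(m, n))
    k (U : 'M[R]_(m, k)) : Prop :=
  exists S V, svd_trunc delta A U S V.

Definition is_qr m n k (A : 'M[R]_(m, n))
    (Q : 'M[R]_(m, k)) (T : 'M[R]_(k, n)) : Prop :=
  [/\ orthonormal_cols Q, is_trig_mx T^T & A = Q *m T].

(* A core of size r x n x u, stored as its n slices of size r x u. *)
Definition core (r n u : nat) := {ffun 'I_n -> 'M[R]_(r, u)}.

Definition unfold_left r n u (G : core r n u) : 'M[R]_(r * n, u) :=
  \matrix_(k, b) G (unfuse k).2 (unfuse k).1 b.
Definition fold_left r n u (A : 'M[R]_(r * n, u)) : core r n u :=
  [ffun i => \matrix_(a, b) A (fuse a i) b].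

Definition unfold_right r n u (G : core r n u) : 'M[R]_(r, n * u) :=
  \matrix_(a, k) G (unfuse k).1 a (unfuse k).2.
Definition fold_right r n u (A : 'M[R]_(r, n * u)) : core r n u :=
  [ffun i => \matrix_(a, b) A a (fuse i b)].

(* Rows: the free index; columns: the two auxiliary indices. *)
Definition unfold_free r n u (G : core r n u) : 'M[R]_(n, r * u) :=
  \matrix_(i, k) G i (unfuse k).1 (unfuse k).2.
Definition fold_free r n u (A : 'M[R]_(n, r * u)) : core r n u :=
  [ffun i => \matrix_(a, b) A i (fuse a b)].

Definition left_orthogonal r n u (G : core r n u) : Prop :=
  orthonormal_cols (unfold_left G).
Definition right_orthogonal r n u (G : core r n u) : Prop :=
  orthonormal_rows (unfold_right G).

(* [train r s d]: a chain of cores with free dimensions d, first auxiliary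
   dimension r and last auxiliary dimension s; a TT is a [train 1 1 d]. *)
Inductive train : nat -> nat -> seq nat -> Type :=
| TNil r : train r r [::]
| TCons r n u s d : core r n u -> train u s d -> train r s (n :: d).

Fixpoint tcat r u s d1 d2 (t1 : train r u d1) :
    train u s d2 -> train r s (d1 ++ d2) :=
  match t1 in train r u d1 return train u s d2 -> train r s (d1 ++ d2) with
  | TNil r => id
  | TCons r n v u d1 G t1' => fun t2 => TCons G (tcat t1' t2)
  end.

(* The matrix products are the sums over the connecting auxiliary indices. *)
Fixpoint contract r s d (t : train r s d) : midx d -> 'M[R]_(r, s) :=
  match t in train r s d return midx d -> 'M[R]_(r, s) with
  | TNil r => fun=> 1%:M
  | TCons r n u s d G t' => fun i : midx (n :: d) => G i.1 *m contract t' i.2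
  end.

Definition tt_tensor d (t : train 1 1 d) : tensor d :=
  [ffun i => contract t i 0 0].

Fixpoint all_right_orthogonal r s d (t : train r s d) : Prop :=
  if t is TCons _ _ _ _ _ G t' then
    right_orthogonal G /\ all_right_orthogonal t'
  else True.

Fixpoint mixed_canonical r s d (p : nat) (t : train r s d) : Prop :=
  match t, p with
  | TNil _, _ => False
  | TCons _ _ _ _ _ _ t', 0 => all_right_orthogonal t'
  | TCons _ _ _ _ _ G t', p'.+1 => left_orthogonal G /\ mixed_canonical p' t'
  end.

Definition supercore r u b (t : train r u b) : core r (prodn b) u :=
  [ffun i => contract t (unlin i)].

(* [supercores B t t']: t' is t with the cores of each block of B replaced by
   their supercore. *)
Inductive supercores :
  forall r s d e, blocking d e -> train r s d -> train r s e -> Prop :=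
| SCNil r : supercores BNil (TNil r) (TNil r)
| SCCons r u s b d e (B : blocking d e) (t1 : train r u b)
    (t : train u s d) (t' : train u s e) :
    supercores B t t' ->
    supercores (BCons b B) (tcat t1 t) (TCons (supercore t1) t').

Definition unfuse_single r n u (G : core r (prodn [:: n]) u) : core r n u :=
  [ffun i => G (lin ((i, tt) : midx [:: n]))].

Definition unfold_pair r n m u (G : core r (prodn [:: n; m]) u) :
    'M[R]_(r * n, m * u) :=
  \matrix_(k, l) G (lin (((unfuse k).2, ((unfuse l).1, tt)) : midx [:: n; m]))
                   (unfuse k).1 (unfuse l).2.

Inductive svd_split :
  forall r s d e, blocking d e -> train r s e -> train r s d -> Prop :=
| SplitNil r : svd_split BNil (TNil r) (TNil r)
| SplitSingle r n u s d e (P : blocking d e) (G : core r (prodn [:: n]) u)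
    (t : train u s e) (t' : train u s d) :
    svd_split P t t' ->
    svd_split (BCons [:: n] P) (TCons G t) (TCons (unfuse_single G) t')
| SplitPairL r n m u s k d e (P : blocking d e)
    (G : core r (prodn [:: n; m]) u) (t : train u s e) (t' : train u s d)
    (U : 'M[R]_(r * n, k)) S (V : 'M[R]_(m * u, k)) :
    svd_trunc 0 (unfold_pair G) U S V ->
    svd_split P t t' ->
    svd_split (BCons [:: n; m] P) (TCons G t)
      (TCons (fold_left U) (TCons (fold_right (S *m V^T)) t'))
| SplitPairR r n m u s k d e (P : blocking d e)
    (G : core r (prodn [:: n; m]) u) (t : train u s e) (t' : train u s d)
    (U : 'M[R]_(r * n, k)) S (V : 'M[R]_(m * u, k)) :
    svd_trunc 0 (unfold_pair G) U S V ->
    svd_split P t t' ->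
    svd_split (BCons [:: n; m] P) (TCons G t)
      (TCons (fold_left (U *m S)) (TCons (fold_right V^T) t')).

(* [factors d e]: for each mode either no matrix ([FSkip], the mode is left
   alone) or a matrix whose rows are indexed by the mode in d and whose columns
   by the mode in e. *)
Inductive factors : seq nat -> seq nat -> Type :=
| FNil : factors [::] [::]
| FSkip n d e : factors d e -> factors (n :: d) (n :: e)
| FMat n s d e : 'M[R]_(n, s) -> factors d e -> factors (n :: d) (s :: e).

Fixpoint fskip d : factors d d :=
  if d is n :: d' then FSkip n (fskip d') else FNil.

Fixpoint fcat d1 e1 d2 e2 (F1 : factors d1 e1) (F2 : factors d2 e2) :
    factors (d1 ++ d2) (e1 ++ e2) :=
  match F1 in factors d1 e1 return factors (d1 ++ d2) (e1 ++ e2) with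
  | FNil => F2
  | FSkip n _ _ F => FSkip n (fcat F F2)
  | FMat _ _ _ _ U F => FMat U (fcat F F2)
  end.

Fixpoint ftr d e (F : factors d e) : factors e d :=
  match F in factors d e return factors e d with
  | FNil => FNil
  | FSkip n _ _ F' => FSkip n (ftr F')
  | FMat _ _ _ _ U F' => FMat U^T (ftr F')
  end.

Fixpoint fmask d e (F : factors d e) : seq bool :=
  match F with
  | FNil => [::]
  | FSkip _ _ _ F' => false :: fmask F'
  | FMat _ _ _ _ _ F' => true :: fmask F'
  end.

Fixpoint orthonormal_factors d e (F : factors d e) : Prop :=
  match F with
  | FNil => True
  | FSkip _ _ _ F' => orthonormal_factors F'
  | FMat _ _ _ _ U F' => orthonormal_cols U /\ orthonormal_factors F'
  end.

(* The Kronecker product of the matrices of F, with identities for [FSkip]. *)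
Fixpoint fcoef d e (F : factors d e) : midx d -> midx e -> R :=
  match F in factors d e return midx d -> midx e -> R with
  | FNil => fun _ _ => 1
  | FSkip n d e F' => fun (i : midx (n :: d)) (j : midx (n :: e)) =>
      (i.1 == j.1)%:R * fcoef F' i.2 j.2
  | FMat n s d e U F' => fun (i : midx (n :: d)) (j : midx (s :: e)) =>
      U i.1 j.1 * fcoef F' i.2 j.2
  end.

Definition fapply d e (F : factors d e) (T : tensor e) : tensor d :=
  [ffun i => \sum_j fcoef F i j * T j].

Inductive qr_move : forall d, train 1 1 d -> train 1 1 d -> Prop :=
| MoveRight r n v m u d1 d2 k (t1 : train 1 r d1) (G : core r n v)
    (H : core v m u) (t2 : train u 1 d2)
    (Q : 'M[R]_(r * n, k)) (T : 'M[R]_(k, v)) :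
    is_qr (unfold_left G) Q T ->
    qr_move (tcat t1 (TCons G (TCons H t2)))
            (tcat t1 (TCons (fold_left Q)
                       (TCons [ffun i => T *m H i] t2)))
| MoveLeft r n v m u d1 d2 k (t1 : train 1 r d1) (G : core r n v)
    (H : core v m u) (t2 : train u 1 d2)
    (Q : 'M[R]_(m * u, k)) (T : 'M[R]_(k, v)) :
    is_qr (unfold_right H)^T Q T ->
    qr_move (tcat t1 (TCons G (TCons H t2)))
            (tcat t1 (TCons [ffun i => G i *m T^T]
                       (TCons (fold_right Q^T) t2))).

(* [sweep decomp t F t']: some partial TT-to-Tucker sweep from t has recorded
   the factors F and reached the TT t' of the partial Tucker core.  [FSkip]
   marks the (super)cores not processed (so far); [decomp A U] says that U is
   the left factor of an admissible SVD of A. *)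
Inductive sweep
    (decomp : forall m n, 'M[R]_(m, n) -> forall k, 'M[R]_(m, k) -> Prop) :
  forall d e, train 1 1 d -> factors d e -> train 1 1 e -> Prop :=
| SweepStart d (t : train 1 1 d) : sweep decomp t (fskip d) t
| SweepMove d e (t : train 1 1 d) (F : factors d e) (t' t'' : train 1 1 e) :
    sweep decomp t F t' -> qr_move t' t'' -> sweep decomp t F t''
| SweepSVD d1 n d2 e1 e2 r u s (t : train 1 1 (d1 ++ n :: d2))
    (F1 : factors d1 e1) (F2 : factors d2 e2)
    (t1 : train 1 r e1) (G : core r n u) (t2 : train u 1 e2)
    (U : 'M[R]_(n, s)) :
    sweep decomp t (fcat F1 (FSkip n F2)) (tcat t1 (TCons G t2)) ->
    mixed_canonical (size e1) (tcat t1 (TCons G t2)) ->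
    decomp _ _ (unfold_free G) _ U ->
    sweep decomp t (fcat F1 (FMat U F2))
      (tcat t1 (TCons (fold_free (U^T *m unfold_free G)) t2)).

(* P pairs the indices on which the disentanglers act (blocks of size 1 are
   indices without disentangler) and B forms the groups of K indices on which
   the isometries act.  The left index of a pair must be the last index of a
   group of B, so that the pair bridges two adjacent groups. *)
Definition layer_locations (K : nat) d e f
    (P : blocking d e) (B : blocking d f) : Prop :=
  [/\ all (pred2 1 2)%N (shape P), all (pred1 K) (shape B)
    & forall p, nth 0%N (shape P) p = 2 ->
        (K %| (sumn (take p (shape P))).+1)%N].

(* X consists of the disentangler matrices, which are square because X does not
   change the dimensions, and W of the isometry matrices. *)
Definition layer_maps d e f d' (P : blocking d e) (X : factors e e)
    (B : blocking d f) (W : factors f d') : Prop :=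
  [/\ fmask X = [seq l == 2 | l <- shape P], all id (fmask W),
      orthonormal_factors X & orthonormal_factors W].

Inductive mera (K : nat) : seq nat -> Type :=
| Top d : tensor d -> mera K d
| Layer d e f d' (P : blocking d e) (X : factors e e)
    (B : blocking d f) (W : factors f d') :
    layer_locations K P B -> layer_maps P X B W -> mera K d' -> mera K d.

Fixpoint mera_tensor K d (M : mera K d) : tensor d :=
  match M in mera _ d return tensor d with
  | Top _ T => T
  | Layer _ _ _ _ P X B W _ _ M' =>
      let T := tunreshape B (fapply W (mera_tensor M')) in
      tunreshape P (fapply (ftr X) (treshape P T))
  end.

Fixpoint num_isometries K d (M : mera K d) : nat :=
  match M with
  | Top _ _ => 0%N
  | Layer _ _ _ _ _ _ _ W _ _ M' => (count id (fmask W) + num_isometries M')%N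
  end.

(* [meracle delta t M]: M is a possible outcome of the algorithm on the TT t. *)
Inductive meracle K (delta : R) : forall d, train 1 1 d -> mera K d -> Prop :=
| MeracleTop d (t : train 1 1 d) : meracle delta t (Top K (tt_tensor t))
| MeracleLayer d e f d' (P : blocking d e) (Q : factors e e)
    (B : blocking d f) (W : factors f d')
    (hPB : layer_locations K P B) (hQW : layer_maps P (ftr Q) B W)
    (t t2 : train 1 1 d) (t1 t1' : train 1 1 e)
    (t3 : train 1 1 f) (t4 : train 1 1 d') (M : mera K d') :
    supercores P t t1 ->
    sweep full_svd t1 Q t1' ->
    svd_split P t1' t2 ->
    supercores B t2 t3 ->
    sweep (trunc_svd delta) t3 W t4 ->
    meracle delta t4 M ->
    meracle delta t (Layer hPB hQW M).

End Tensors.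

Arguments tensor R d : clear implicits.
Arguments core R r n u : clear implicits.
Arguments train R r s d : clear implicits.
Arguments factors R d e : clear implicits.
Arguments mera R K d : clear implicits.

(* Main.v *)
Require Import Defs.
From mathcomp Require Import all_boot all_order all_algebra.
From mathcomp Require Import ring.
Set Implicit Arguments. Unset Strict Implicit. Unset Printing Implicit Defensive.
Import Order.TTheory GRing.Theory Num.Theory.
Local Open Scope ring_scope.

(* Every step of MERACLE is either exact (supercores, QR moves, full SVDs,
   splittings) or replaces the current tensor X by F^T X for a Kronecker product
   F with orthonormal columns.  For such F, Pythagoras gives
     |X - F Y|^2 = |X - F F^T X|^2 + |F^T X - Y|^2   for every Y.
   Taking Y to be what the rest of the MERA reconstructs shows that the squared
   errors of the successive truncations simply add up.  Because the train is in
   mixed-canonical form at the processed supercore, the error of one truncation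
   equals the error in the unfolding of that supercore, which is at most delta;
   N truncations give N delta^2 = (eps |A|)^2. *)

(** * Multi-indices *)

Lemma fuseK n m (i : 'I_n) (j : 'I_m) : unfuse (fuse i j) = (i, j).
Proof.
have n_gt0 : (0 < n)%N by apply: leq_ltn_trans (ltn_ord i).
rewrite /unfuse; congr (_, _); apply: val_inj => /=.
  by rewrite addnC mulnC modnMDl modn_small.
by rewrite addnC mulnC divnMDl // divn_small // addn0.
Qed.

Lemma unfuseK n m (k : 'I_(n * m)) : fuse (unfuse k).1 (unfuse k).2 = k.
Proof. by apply: val_inj; rewrite /= addnC mulnC -divn_eq. Qed.

Lemma linK b : cancel (@lin b) (@unlin b).
Proof.
elim: b => [|n b IHb]; first by case.
case=> i j; rewrite -[unlin _]/((unfuse (fuse i (lin j))).1,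
  unlin (unfuse (fuse i (lin j))).2).
by rewrite fuseK IHb.
Qed.

Lemma unlinK b : cancel (@unlin b) (@lin b).
Proof.
elim: b => [|n b IHb] k; first by rewrite [RHS]ord1.
rewrite -[lin _]/(fuse (unfuse k).1 (lin (unlin (unfuse k).2))).
by rewrite IHb unfuseK.
Qed.

Lemma icatK b d (i : midx b) (j : midx d) : isplit (icat i j) = (i, j).
Proof. by elim: b i => [|n b IHb] [] //= a i; rewrite IHb. Qed.

Lemma isplitK b d (i : midx (b ++ d)) : icat (isplit i).1 (isplit i).2 = i.
Proof. by elim: b i => [|n b IHb] //= [a i] /=; rewrite IHb. Qed.

Lemma bidxK d e (B : blocking d e) : cancel (bidx B) (bunidx B).
Proof.
elim: B => [|b {}d {}e B IHB] //= i; rewrite linK IHB; exact: isplitK.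
Qed.

Lemma bunidxK d e (B : blocking d e) : cancel (bunidx B) (bidx B).
Proof.
by elim: B => [|b {}d {}e B IHB] //= [k i]; rewrite icatK /= unlinK IHB.
Qed.

Section Theory.
Context {R : rcfType}.
Implicit Types (d e : seq nat) (delta : R).

Lemma sum_fuse n m (f : 'I_(n * m) -> R) :
  \sum_k f k = \sum_i \sum_j f (fuse i j).
Proof.
rewrite pair_big /= (reindex (fun p : 'I_n * 'I_m => fuse p.1 p.2)) //=.
exists (@unfuse n m) => [[i j] _|k _]; [exact: fuseK | exact: unfuseK].
Qed.

Lemma sum_icat (V : nmodType) b d (f : midx (b ++ d) -> V) :
  \sum_k f k = \sum_i \sum_j f (icat i j).
Proof.
rewrite pair_big /= (reindex (fun p : midx b * midx d => icat p.1 p.2)) //=.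
exists (@isplit b d) => [[i j] _|k _]; [exact: icatK | exact: isplitK].
Qed.

Lemma sum_midx_cons (V : nmodType) n d (f : midx (n :: d) -> V) :
  \sum_k f k = \sum_i \sum_j f (i, j).
Proof. by rewrite pair_big /=; apply: eq_bigr => -[]. Qed.

Lemma sum_delta (T : finType) (x : T) (f : T -> R) :
  \sum_y (x == y)%:R * f y = f x.
Proof.
rewrite (bigD1 x) //= eqxx mul1r big1 ?addr0 // => y.
by rewrite eq_sym => /negbTE->; rewrite mul0r.
Qed.

(** * Inner products and factor maps *)

(** The bilinear form behind [frobenius]. Errors are accumulated as [dot f f], since it is squared
    norms that add under Pythagoras. *)
Definition dot (T : finType) (f g : T -> R) : R := \sum_x f x * g x.

Lemma frobeniusE (T : finType) (f : T -> R) :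
  frobenius f = Num.sqrt (dot f f).
Proof. by []. Qed.

Lemma dot_ge0 (T : finType) (f : T -> R) : 0 <= dot f f.
Proof. by apply: sumr_ge0 => x _; rewrite -expr2 sqr_ge0. Qed.

Lemma dot_eq0 (T : finType) (f : T -> R) : dot f f = 0 -> forall x, f x = 0.
Proof.
move=> f0 x; apply/eqP; rewrite -sqrf_eq0 expr2; apply/eqP.
by apply: (psumr_eq0P (P := xpredT)) f0 x isT => y _; rewrite -expr2 sqr_ge0.
Qed.

Lemma frobenius_ge0 (T : finType) (f : T -> R) : 0 <= frobenius f.
Proof. exact: sqrtr_ge0. Qed.

Lemma dot_le_frobenius (T : finType) (f : T -> R) delta :
  frobenius f <= delta -> dot f f <= delta ^+ 2.
Proof.
move=> le_f; rewrite -(sqr_sqrtr (dot_ge0 f)) -frobeniusE ler_pXn2r //.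
  by rewrite nnegrE frobenius_ge0.
by rewrite nnegrE (le_trans (frobenius_ge0 f)).
Qed.

Lemma dot_reindex (T T' : finType) (h : T -> T') (f : T' -> R) :
  bijective h -> dot (f \o h) (f \o h) = dot f f.
Proof. by move=> bij_h; rewrite /dot [RHS](reindex h) //; apply: onW_bij. Qed.

Lemma dot_tunreshape d e (B : blocking d e) (S T : tensor R e) :
  dot (tunreshape B S - tunreshape B T) (tunreshape B S - tunreshape B T) =
  dot (S - T) (S - T).
Proof.
rewrite -[RHS](dot_reindex _ (Bijective (bidxK B) (bunidxK B))).
by apply: eq_bigr => i _; rewrite /= !ffunE.
Qed.

Lemma tunreshapeK d e (B : blocking d e) :
  cancel (@tunreshape R d e B) (treshape B).
Proof. by move=> T; apply/ffunP => i; rewrite !ffunE bunidxK. Qed.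

Lemma treshapeK d e (B : blocking d e) :
  cancel (@treshape R d e B) (tunreshape B).
Proof. by move=> T; apply/ffunP => i; rewrite !ffunE bidxK. Qed.

Lemma fcoef_tr d e (F : factors R d e) i j : fcoef (ftr F) j i = fcoef F i j.
Proof.
elim: F i j => [|n d' e' F IHF|n s d' e' U F IHF] //= i j.
  by rewrite IHF eq_sym.
by rewrite IHF mxE.
Qed.

Lemma fcoef_skip d (i j : midx d) : fcoef (fskip d) i j = (i == j)%:R :> R.
Proof.
elim: d i j => [|n d IHd]; first by case; case.
by case=> a i [b j] /=; rewrite IHd -natrM mulnb.
Qed.

Lemma fcoef_cat d1 e1 d2 e2 (F1 : factors R d1 e1) (F2 : factors R d2 e2)
    i1 i2 j1 j2 :
  fcoef (fcat F1 F2) (icat i1 i2) (icat j1 j2) = fcoef F1 i1 j1 * fcoef F2 i2 j2.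
Proof.
elim: F1 i1 j1 => [|n d' e' F IHF|n s d' e' U F IHF] /=.
- by move=> [] []; rewrite mul1r.
- by move=> i1 j1; rewrite IHF mulrA.
- by move=> i1 j1; rewrite IHF mulrA.
Qed.

(** The columns of a Kronecker product are products of columns, so their inner products factor mode
    by mode; a skipped mode contributes an identity matrix. *)
Lemma fcoef_ortho d e (F : factors R d e) j j' :
  orthonormal_factors F ->
  \sum_i fcoef F i j * fcoef F i j' = (j == j')%:R.
Proof.
elim: F j j' => [|n d' e' F IHF|n s d' e' U F IHF] /=.
- by move=> [] [] _; rewrite (bigD1 tt) //= big1 ?addr0 ?mulr1 // => -[].
- move=> [a j] [a' j'] oF /=; rewrite sum_midx_cons /=.
  under eq_bigr => b _.
    under eq_bigr => i _ do rewrite mulrACA.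
    rewrite -mulr_sumr IHF // -mulrA eq_sym; over.
  by rewrite sum_delta -natrM mulnb.
- move=> [a j] [a' j'] [oU oF] /=; rewrite sum_midx_cons /=.
  under eq_bigr => b _.
    under eq_bigr => i _ do rewrite mulrACA.
    rewrite -mulr_sumr IHF //; over.
  rewrite -mulr_suml.
  have -> : \sum_i U i a * U i a' = (a == a')%:R.
    move/matrixP/(_ a a'): oU; rewrite !mxE => <-.
    by apply: eq_bigr => i _; rewrite mxE.
  by rewrite -natrM mulnb.
Qed.

Lemma fapplyB d e (F : factors R d e) S T :
  fapply F (S - T) = fapply F S - fapply F T.
Proof.
apply/ffunP => i; rewrite !ffunE -sumrB.
by apply: eq_bigr => j _; rewrite !ffunE mulrBr.
Qed.

Lemma dot_fapply d e (F : factors R d e) (S : tensor R e) (T : tensor R d) :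
  dot (fapply F S) T = dot S (fapply (ftr F) T).
Proof.
rewrite /dot; under eq_bigr => i _ do rewrite ffunE mulr_suml.
rewrite exchange_big; apply: eq_bigr => j _ /=; rewrite ffunE mulr_sumr.
by apply: eq_bigr => i _; rewrite fcoef_tr; ring.
Qed.

Lemma fapply_trK d e (F : factors R d e) T :
  orthonormal_factors F -> fapply (ftr F) (fapply F T) = T.
Proof.
move=> oF; apply/ffunP => j; rewrite ffunE.
under eq_bigr => i _ do rewrite fcoef_tr ffunE mulr_sumr.
rewrite exchange_big /= -[RHS]sum_delta; apply: eq_bigr => k _.
by rewrite -(fcoef_ortho _ _ oF) mulr_suml; apply: eq_bigr => i _; ring.
Qed.

(** The residual of the projection is killed by [ftr F], hence orthogonal to the range of [F]. [Y]
    stays arbitrary so that it can be a truncated core within a sweep or the reconstruction from the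
    later layers. *)
Lemma fapply_pythagoras d e (F : factors R d e) (X : tensor R d)
    (Y : tensor R e) :
  orthonormal_factors F ->
  dot (X - fapply F Y) (X - fapply F Y) =
  dot (X - fapply F (fapply (ftr F) X)) (X - fapply F (fapply (ftr F) X)) +
  dot (fapply (ftr F) X - Y) (fapply (ftr F) X - Y).
Proof.
move=> oF; set Z := fapply (ftr F) X; set P := X - fapply F Z.
have -> : X - fapply F Y = P + fapply F (Z - Y).
  by rewrite fapplyB addrA subrK.
have FP : fapply (ftr F) P = 0 by rewrite /P fapplyB fapply_trK // subrr.
have PF : dot (fapply F (Z - Y)) P = 0.
  by rewrite dot_fapply FP; apply: big1 => j _; rewrite [X in _ * X]ffunE mulr0.
have FF : dot (fapply F (Z - Y)) (fapply F (Z - Y)) = dot (Z - Y) (Z - Y).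
  by rewrite dot_fapply fapply_trK.
set Q := fapply F (Z - Y) in PF FF *.
have -> : dot (P + Q) (P + Q) = dot P P + dot Q P *+ 2 + dot Q Q.
  rewrite /dot -sumrMnl -!big_split; apply: eq_bigr => i _ /=.
  by rewrite ffunE; ring.
by rewrite PF FF mul0rn addr0.
Qed.

Lemma ftr_cat d1 e1 d2 e2 (F1 : factors R d1 e1) (F2 : factors R d2 e2) :
  ftr (fcat F1 F2) = fcat (ftr F1) (ftr F2).
Proof. by elim: F1 => //= *; f_equal. Qed.

Lemma ftr_skip d : ftr (fskip d) = fskip d :> factors R d d.
Proof. by elim: d => //= n d ->. Qed.

Lemma ftrK d e (F : factors R d e) : ftr (ftr F) = F.
Proof. by elim: F => [|n d1 e1 F /= ->|n s d1 e1 U F /= ->] //; rewrite trmxK. Qed.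

Lemma fmask_cat d1 e1 d2 e2 (F1 : factors R d1 e1) (F2 : factors R d2 e2) :
  fmask (fcat F1 F2) = fmask F1 ++ fmask F2.
Proof. by elim: F1 => //= [|] *; f_equal. Qed.

Lemma fmask_skip d : count id (fmask (@fskip R d)) = 0%N.
Proof. by elim: d. Qed.

Lemma orthonormal_factors_cat d1 e1 d2 e2
    (F1 : factors R d1 e1) (F2 : factors R d2 e2) :
  orthonormal_factors (fcat F1 F2) <->
  orthonormal_factors F1 /\ orthonormal_factors F2.
Proof. by elim: F1 => /= [|n d' e' F ->|n s d' e' U F ->]; tauto. Qed.

Lemma orthonormal_factors_skip d : orthonormal_factors (@fskip R d).
Proof. by elim: d. Qed.

Lemma fapply_skip d (T : tensor R d) : fapply (fskip d) T = T.
Proof.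
apply/ffunP => i; rewrite ffunE.
by under eq_bigr => j _ do rewrite fcoef_skip; rewrite sum_delta.
Qed.

(** * Factors acting on a single mode *)

Definition fmode e1 n s e2 (U : 'M[R]_(n, s)) :
    factors R (e1 ++ n :: e2) (e1 ++ s :: e2) :=
  fcat (fskip e1) (FMat U (fskip e2)).

Lemma ftr_mode e1 n s e2 (U : 'M[R]_(n, s)) :
  ftr (fmode e1 e2 U) = fmode e1 e2 U^T.
Proof. by rewrite ftr_cat /= !ftr_skip. Qed.

Lemma fapply_mode e1 n s e2 (U : 'M[R]_(n, s)) T i a k :
  fapply (fmode e1 e2 U) T (icat i ((a, k) : midx (n :: e2))) =
  \sum_b U a b * T (icat i ((b, k) : midx (s :: e2))).
Proof.
rewrite ffunE sum_icat.
under eq_bigr => i' _.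
  under eq_bigr => j' _ do rewrite fcoef_cat /= !fcoef_skip -mulrA.
  rewrite -mulr_sumr; over.
rewrite sum_delta sum_midx_cons; apply: eq_bigr => b _ /=.
under eq_bigr => j _ do rewrite [U _ _ * _]mulrC -mulrA.
by rewrite sum_delta.
Qed.

(** The mixed-product rule: F1 ⊗ U ⊗ F2 = (F1 ⊗ I ⊗ F2)(I ⊗ U ⊗ I). It separates the factor recorded
    last from the earlier ones. *)
Lemma fcoef_mat_mode d1 e1 d2 e2 n s (F1 : factors R d1 e1)
    (F2 : factors R d2 e2) (U : 'M[R]_(n, s)) i k :
  fcoef (fcat F1 (FMat U F2)) i k =
  \sum_j fcoef (fcat F1 (FSkip n F2)) i j * fcoef (fmode e1 e2 U) j k.
Proof.
rewrite -[i]isplitK -[k]isplitK.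
case: (isplit i) => i1 [a i2]; case: (isplit k) => k1 [b k2] /=.
rewrite fcoef_cat /= sum_icat -[LHS](sum_delta k1 (fun j1 =>
  fcoef F1 i1 j1 * (U a b * fcoef F2 i2 k2))).
apply: eq_bigr => j1 _; rewrite sum_midx_cons /=.
(* Kronecker deltas reinsert the sums over the intermediate indices, so that the two sides can be
   compared term by term. *)
transitivity (\sum_c (a == c)%:R * \sum_j2 (k2 == j2)%:R *
    ((k1 == j1)%:R * (fcoef F1 i1 j1 * (U c b * fcoef F2 i2 j2)))).
  by rewrite sum_delta (sum_delta k2 (fun j2 =>
    (k1 == j1)%:R * (fcoef F1 i1 j1 * (U a b * fcoef F2 i2 j2)))).
apply: eq_bigr => c _; rewrite mulr_sumr; apply: eq_bigr => j2 _.
by rewrite !fcoef_cat /= !fcoef_skip [k1 == _]eq_sym [k2 == _]eq_sym; ring.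
Qed.

Section FactorStep.
Context {d1 e1 d2 e2 : seq nat} {n s : nat}.
Variables (F1 : factors R d1 e1) (F2 : factors R d2 e2) (U : 'M[R]_(n, s)).

Lemma fapply_mat_mode T :
  fapply (fcat F1 (FMat U F2)) T =
  fapply (fcat F1 (FSkip n F2)) (fapply (fmode e1 e2 U) T).
Proof.
apply/ffunP => i; rewrite !ffunE.
under eq_bigr => k _ do rewrite fcoef_mat_mode mulr_suml.
rewrite exchange_big; apply: eq_bigr => j _ /=; rewrite ffunE mulr_sumr.
by apply: eq_bigr => k _; rewrite mulrA.
Qed.

Lemma fapply_tr_mat_mode T :
  fapply (ftr (fcat F1 (FMat U F2))) T =
  fapply (ftr (fmode e1 e2 U)) (fapply (ftr (fcat F1 (FSkip n F2))) T).
Proof.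
apply/ffunP => k; rewrite !ffunE.
under eq_bigr => i _ do rewrite fcoef_tr fcoef_mat_mode mulr_suml.
rewrite exchange_big; apply: eq_bigr => j _ /=; rewrite ffunE mulr_sumr.
by apply: eq_bigr => i _; rewrite !fcoef_tr; ring.
Qed.

End FactorStep.

(** * Tensor trains *)

Lemma contract_cat r u s d1 d2 (t1 : train R r u d1) (t2 : train R u s d2) i j :
  contract (tcat t1 t2) (icat i j) = contract t1 i *m contract t2 j.
Proof.
elim: t1 t2 i => [r'|r' n v w d G t1 IHt] t2 /=; first by case; rewrite mul1mx.
by case=> a i; rewrite IHt mulmxA.
Qed.

Lemma tt_tensor_cat r d1 d2 (t1 : train R 1 r d1) (t2 : train R r 1 d2) i j :
  tt_tensor (tcat t1 t2) (icat i j) = (contract t1 i *m contract t2 j) 0 0.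
Proof. by rewrite ffunE contract_cat. Qed.

Lemma supercores_contract r s d e (B : blocking d e) (t : train R r s d) t' :
  supercores B t t' -> forall i, contract t' i = contract t (bunidx B i).
Proof.
elim=> [//|{}r u {}s b {}d {}e {}B t1 {}t {}t' _ IH] [k i] /=.
by rewrite contract_cat ffunE IH.
Qed.

Lemma supercores_tensor d e (B : blocking d e) (t : train R 1 1 d) t' :
  supercores B t t' -> tt_tensor t = tunreshape B (tt_tensor t').
Proof.
move=> tt'; apply: (canRL (treshapeK B)); apply/ffunP => i; rewrite !ffunE.
by rewrite (supercores_contract tt').
Qed.

Lemma fold_left_mul r n u k (G : core R r n u) (Q : 'M_(r * n, k)) T i :
  unfold_left G = Q *m T -> fold_left Q i *m T = G i.
Proof.
move=> GE; apply/matrixP => a b; move/matrixP/(_ (fuse a i) b): GE.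
by rewrite !mxE fuseK => ->; apply: eq_bigr => c _; rewrite ffunE mxE.
Qed.

Lemma fold_right_mul r n u k (G : core R r n u) (Q : 'M_(k, n * u)) T i :
  unfold_right G = T *m Q -> T *m fold_right Q i = G i.
Proof.
move=> GE; apply/matrixP => a b; move/matrixP/(_ a (fuse i b)): GE.
by rewrite !mxE fuseK => ->; apply: eq_bigr => c _; rewrite ffunE mxE.
Qed.

(** The triangular factor only passes from one core to its neighbour, which leaves the product of
    the two slices unchanged. *)
Lemma qr_move_tensor d (t t' : train R 1 1 d) :
  qr_move t t' -> tt_tensor t' = tt_tensor t.
Proof.
case=> r n v m u d1 d2 k t1 G H t2 Q T [_ _ QT]; apply/ffunP => i;
  rewrite -[i]isplitK !tt_tensor_cat; case: (isplit i) => i1 [a [b i2]] /=.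
  by rewrite (ffunE (fun j => T *m H j)) -(fold_left_mul a QT) !mulmxA.
(* A left move factors the transposed unfolding; transposing back puts the orthogonal factor on the
   right. *)
have HE : unfold_right H = T^T *m Q^T by rewrite -trmx_mul -QT trmxK.
by rewrite (ffunE (fun j => G j *m T^T)) -(fold_right_mul b HE) !mulmxA.
Qed.

Lemma mxnorm_le0 m n (A : 'M[R]_(m, n)) : mxnorm A <= 0 -> A = 0.
Proof.
move/dot_le_frobenius; rewrite expr0n /= => A_le0.
apply/matrixP => i j; rewrite mxE.
by apply: (dot_eq0 (f := fun x => A x.1 x.2) _ (i, j)); apply: le_anti;
  rewrite A_le0 dot_ge0.
Qed.

Lemma unfold_pair_mul r n m u k (G : core R r (prodn [:: n; m]) u)
    (X : 'M_(r * n, k)) (Y : 'M_(k, m * u)) i j :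
  unfold_pair G = X *m Y ->
  fold_left X i *m fold_right Y j =
  G (lin ((i, (j, tt)) : midx [:: n; m])).
Proof.
move=> GE; apply/matrixP => a b; move/matrixP/(_ (fuse a i) (fuse j b)): GE.
by rewrite !mxE !fuseK => ->; apply: eq_bigr => c _; rewrite !ffunE !mxE.
Qed.

(** Tolerance 0 turns the truncated SVD into an exact factorization. Whether [S] joins the left or
    the right factor is a matter of associativity. *)
Lemma svd_split_contract r s d e (P : blocking d e) (t : train R r s e) t' :
  svd_split P t t' -> forall i, contract t' i = contract t (bidx P i).
Proof.
elim=> {r s d e P t t'} //=.
- by move=> r n u s d e P G t t' _ IH [a i] /=; rewrite ffunE IH.
- move=> r n m u s k d e P G t t' U S V [U' [S' [V' [_ _ _]]]].
  move/mxnorm_le0/subr0_eq; rewrite -mulmxA => GE _ IH [a [b i]] /=.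
  by rewrite mulmxA (unfold_pair_mul _ _ GE) IH.
- move=> r n m u s k d e P G t t' U S V [U' [S' [V' [_ _ _]]]].
  move/mxnorm_le0/subr0_eq => GE _ IH [a [b i]] /=.
  by rewrite mulmxA (unfold_pair_mul _ _ GE) IH.
Qed.

Lemma svd_split_tensor d e (P : blocking d e) (t : train R 1 1 e) t' :
  svd_split P t t' -> tt_tensor t' = tunreshape P (tt_tensor t).
Proof.
by move=> tt'; apply/ffunP => i; rewrite !ffunE (svd_split_contract tt').
Qed.

(** * Mixed-canonical trains *)

Fixpoint all_left_orthogonal r s d (t : train R r s d) : Prop :=
  if t is TCons _ _ _ _ _ G t' then
    left_orthogonal G /\ all_left_orthogonal t'
  else True.

Lemma mixed_canonical_cat r u v n s d1 d2 (t1 : train R r u d1)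
    (G : core R u n v) (t2 : train R v s d2) :
  mixed_canonical (size d1) (tcat t1 (TCons G t2)) ->
  all_left_orthogonal t1 /\ all_right_orthogonal t2.
Proof.
by elim: t1 G => //= r' m w u' d H t1 IHt G [? /IHt[]].
Qed.

Lemma left_orthogonal_sum r n u (G : core R r n u) :
  left_orthogonal G -> \sum_i (G i)^T *m G i = 1%:M.
Proof.
move=> <-; apply/matrixP => a b; rewrite summxE !mxE sum_fuse exchange_big.
apply: eq_bigr => i _; rewrite mxE; apply: eq_bigr => c _.
by rewrite !mxE fuseK.
Qed.

Lemma right_orthogonal_sum r n u (G : core R r n u) :
  right_orthogonal G -> \sum_i G i *m (G i)^T = 1%:M.
Proof.
move=> <-; apply/matrixP => a b; rewrite summxE !mxE sum_fuse.
apply: eq_bigr => i _; rewrite mxE; apply: eq_bigr => c _.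
by rewrite !mxE fuseK.
Qed.

(** The product collapses from the inside out: the two copies of the first core meet in the middle
    and sum to the identity, which leaves the same sum for the tail. *)
Lemma all_left_orthogonal_sum r s d (t : train R r s d) :
  all_left_orthogonal t -> \sum_i (contract t i)^T *m contract t i = 1%:M.
Proof.
elim: t => [r'|r' n u s' d' G t IHt] /=.
  by move=> _; rewrite (bigD1 tt) //= big1 => [|[] //]; rewrite addr0 trmx1 mul1mx.
case=> /left_orthogonal_sum GG /IHt <-.
rewrite sum_midx_cons exchange_big; apply: eq_bigr => i _ /=.
under eq_bigr => a _ do rewrite trmx_mul mulmxA -[_ *m _ *m G a]mulmxA.
by rewrite -mulmx_suml -mulmx_sumr GG mulmx1.
Qed.

Lemma all_right_orthogonal_sum r s d (t : train R r s d) :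
  all_right_orthogonal t -> \sum_i contract t i *m (contract t i)^T = 1%:M.
Proof.
elim: t => [r'|r' n u s' d' G t IHt] /=.
  by move=> _; rewrite (bigD1 tt) //= big1 => [|[] //]; rewrite addr0 trmx1 mul1mx.
case=> /right_orthogonal_sum <- /IHt tt1.
rewrite sum_midx_cons; apply: eq_bigr => a _ /=.
under eq_bigr => i _ do
  rewrite trmx_mul mulmxA -[G a *m _ *m _]mulmxA.
by rewrite -mulmx_suml -mulmx_sumr tt1 mulmx1.
Qed.

(** * Norm of a train read off at its canonical site *)

Lemma dot_mx m n (A : 'M[R]_(m, n)) :
  dot (fun x => A x.1 x.2) (fun x => A x.1 x.2) = \tr (A^T *m A).
Proof.
rewrite /dot -(pair_big xpredT xpredT (fun i j => A i j * A i j)) /=.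
rewrite exchange_big; apply: eq_bigr => j _; rewrite mxE.
by apply: eq_bigr => i _; rewrite mxE.
Qed.

Lemma trace_unfold_free r n u (G : core R r n u) :
  \tr ((unfold_free G)^T *m unfold_free G) = \sum_i \tr ((G i)^T *m G i).
Proof.
rewrite -dot_mx /dot.
rewrite -(pair_big xpredT xpredT
  (fun i k => unfold_free G i k * unfold_free G i k)) /=.
apply: eq_bigr => i _; rewrite -dot_mx /dot sum_fuse.
rewrite -(pair_big xpredT xpredT (fun a b => G i a b * G i a b)) /=.
by apply: eq_bigr => a _; apply: eq_bigr => b _; rewrite !mxE fuseK.
Qed.

(** The sum over [i] collapses directly; cyclicity of the trace then brings each [Y j] next to its
    transpose, and the sum over [j] collapses too. *)
Lemma trace_orthogonal_sum (I J : finType) p q r s (X : I -> 'M[R]_(p, q))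
    (Y : J -> 'M[R]_(r, s)) (G : 'M[R]_(q, r)) :
  \sum_i (X i)^T *m X i = 1%:M -> \sum_j Y j *m (Y j)^T = 1%:M ->
  \sum_i \sum_j \tr ((X i *m (G *m Y j))^T *m (X i *m (G *m Y j))) =
  \tr (G^T *m G).
Proof.
move=> XX YY; rewrite exchange_big /=.
transitivity (\sum_j \tr (G^T *m (G *m (Y j *m (Y j)^T)))).
  apply: eq_bigr => j _; rewrite -raddf_sum /=.
  under eq_bigr => i _ do
    rewrite trmx_mul mulmxA -[_ *m (X i)^T *m X i]mulmxA.
  rewrite -mulmx_suml -mulmx_sumr XX mulmx1 trmx_mul -mulmxA mxtrace_mulC.
  by rewrite !mulmxA.
by rewrite -raddf_sum -!mulmx_sumr YY mulmx1.
Qed.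

(** The cores on either side of the site act as isometries, so the norm of the whole tensor sits in
    [G]. This turns the error of a truncation into the error of a matrix. *)
Lemma dot_tt_tensor r u n d1 d2 (t1 : train R 1 r d1) (G : core R r n u)
    (t2 : train R u 1 d2) :
  all_left_orthogonal t1 -> all_right_orthogonal t2 ->
  dot (tt_tensor (tcat t1 (TCons G t2))) (tt_tensor (tcat t1 (TCons G t2))) =
  \tr ((unfold_free G)^T *m unfold_free G).
Proof.
move=> /all_left_orthogonal_sum oL /all_right_orthogonal_sum oR.
rewrite /dot sum_icat trace_unfold_free.
under eq_bigr => i _ do rewrite sum_midx_cons.
rewrite exchange_big; apply: eq_bigr => a _ /=.
rewrite -(trace_orthogonal_sum (G a) oL oR); apply: eq_bigr => i _.
apply: eq_bigr => j _; rewrite !tt_tensor_cat /=.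
(* The slices of the whole train are 1 x 1, so the trace is the square of a single entry. *)
by rewrite trace_mx11 [RHS]mxE big_ord1 [X in _ = X * _]mxE.
Qed.

(** Entries of the tensor are linear in the slices of [G], so mixing these slices mixes the
    corresponding mode. With M = U^T this is the update made by a sweep. *)
Lemma tt_tensor_mode r n s u e1 e2 (t1 : train R 1 r e1) (G : core R r n u)
    (t2 : train R u 1 e2) (M : 'M_(s, n)) :
  tt_tensor (tcat t1 (TCons (fold_free (M *m unfold_free G)) t2)) =
  fapply (fmode e1 e2 M) (tt_tensor (tcat t1 (TCons G t2))).
Proof.
apply/ffunP => i; rewrite -[i]isplitK; case: (isplit i) => i1 [a i2] /=.
rewrite fapply_mode tt_tensor_cat /=.
have -> : fold_free (M *m unfold_free G) a = \sum_b M a b *: G b.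
  apply/matrixP => x y; rewrite ffunE !mxE summxE.
  by apply: eq_bigr => b _; rewrite !mxE fuseK.
rewrite mulmx_suml mulmx_sumr summxE; apply: eq_bigr => b _.
by rewrite tt_tensor_cat /= -scalemxAl -scalemxAr mxE.
Qed.

(** Linearity in one core makes a truncation error again a train with the same neighbours, to which
    [dot_tt_tensor] applies. *)
Lemma tt_tensorB r n u e1 e2 (t1 : train R 1 r e1) (G H : core R r n u)
    (t2 : train R u 1 e2) :
  tt_tensor (tcat t1 (TCons G t2)) - tt_tensor (tcat t1 (TCons H t2)) =
  tt_tensor (tcat t1 (TCons (G - H) t2)).
Proof.
apply/ffunP => i; rewrite -[i]isplitK; case: (isplit i) => i1 [a i2] /=.
have GH : (G - H) a = G a - H a by rewrite !ffunE.
rewrite !ffunE !contract_cat /= GH mulmxBl mulmxBr.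
by rewrite [RHS]mxE; congr (_ + _); rewrite [RHS]mxE.
Qed.

(** * Sweeps *)

(* It follows that the discarded part of a truncated SVD bounds the projection
   error, whatever singular values and right factor were computed. *)
Lemma projection_best m n k (A : 'M[R]_(m, n)) (U : 'M_(m, k)) (Y : 'M_(k, n)) :
  orthonormal_cols U ->
  mxnorm (A - U *m (U^T *m A)) <= mxnorm (A - U *m Y).
Proof.
move=> oU; rewrite /mxnorm !frobeniusE ler_wsqrtr // !dot_mx.
set P := A - U *m (U^T *m A); set Z := U^T *m A - Y.
have -> : A - U *m Y = P + U *m Z.
  by rewrite mulmxBr addrA subrK.
(* [P] is orthogonal to the columns of [U], so the cross terms vanish and only the squared norm of
   [Z] is added to that of [P]. *)
have UP : U^T *m P = 0.
  by rewrite mulmxBr [U^T *m (U *m _)]mulmxA oU mul1mx subrr.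
clearbody P Z.
have PU : P^T *m U = 0 by apply: trmx_inj; rewrite trmx_mul trmxK UP trmx0.
rewrite [(_ + _)^T]linearD /= mulmxDl !mulmxDr trmx_mul.
rewrite [P^T *m (U *m Z)]mulmxA PU mul0mx addr0 -[_ *m U^T *m P]mulmxA UP.
rewrite mulmx0 add0r -[_ *m U^T *m _]mulmxA [U^T *m (U *m Z)]mulmxA oU mul1mx.
by rewrite linearD /= lerDl -dot_mx dot_ge0.
Qed.

(** What the error analysis needs from an SVD, stated so that sweeps with full and with truncated
    SVDs share one proof. *)
Definition admissible
    (decomp : forall m n, 'M[R]_(m, n) -> forall k, 'M[R]_(m, k) -> Prop)
    delta :=
  forall m n (A : 'M[R]_(m, n)) k (U : 'M[R]_(m, k)), decomp m n A k U ->
  orthonormal_cols U /\ mxnorm (A - U *m (U^T *m A)) <= delta.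

Lemma trunc_svd_admissible delta : admissible (trunc_svd delta) delta.
Proof.
move=> m n A k U [S [V [U' [S' [V' [[oU' _ _ _] k_range [UE _ _] errA]]]]]].
have oU : orthonormal_cols U.
  rewrite /orthonormal_cols UE trmx_mul mulmxA -[_ *m U'^T *m U']mulmxA oU'.
  (* Since [k <= m], the selection picks [k] actual columns of [U'], and the selectors multiply to
     the identity. *)
  rewrite mulmx1 tr_pid_mx mul_pid_mx minnn (minn_idPr _) ?pid_mx_1 //.
  by have /andP[_] := k_range; rewrite leq_min => /andP[].
split=> //; apply: le_trans errA; rewrite -mulmxA; exact: projection_best.
Qed.

(** A square matrix with orthonormal columns also has orthonormal rows, so projecting onto its range
    changes nothing. *)
Lemma full_svd_admissible : admissible full_svd 0.
Proof.
move=> m n A k U [{}U S V [oU _ _ _]]; split=> //.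
rewrite mulmxA (mulmx1C oU) mul1mx subrr /mxnorm frobeniusE /dot.
by rewrite big1 ?sqrtr0 // => x _; rewrite mxE mulr0.
Qed.

(** The three claims form one induction invariant: the first permits Pythagoras at the next SVD, and
    the second identifies its last term with an error of the current train. *)
Lemma sweep_error decomp delta d e (t : train R 1 1 d) (F : factors R d e)
    (t' : train R 1 1 e) :
  admissible decomp delta -> sweep decomp t F t' ->
  [/\ orthonormal_factors F, tt_tensor t' = fapply (ftr F) (tt_tensor t)
    & dot (tt_tensor t - fapply F (tt_tensor t'))
          (tt_tensor t - fapply F (tt_tensor t')) <=
      (count id (fmask F))%:R * delta ^+ 2].
Proof.
move=> adm; elim=> {d e t F t'}.
- move=> d t; rewrite ftr_skip !fapply_skip subrr fmask_skip mul0r.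
  split=> //; first exact: orthonormal_factors_skip.
  by rewrite /dot big1 // => i _; rewrite ffunE mulr0.
- by move=> d e t F t' t'' _ IH /qr_move_tensor->.
- move=> d1 n d2 e1 e2 r u s t F1 F2 t1 G t2 U _ [oF CE err] canon.
  move=> /adm[oU errU].
  have [oL oR] := mixed_canonical_cat canon.
  rewrite fapply_tr_mat_mode -CE ftr_mode -tt_tensor_mode.
  split=> //.
    move/orthonormal_factors_cat: oF => [oF1 oF2].
    by apply/orthonormal_factors_cat; split.
  (* Pythagoras for the earlier factors: one term is the error so far, the other the error of this
     SVD alone, measured on the current partial core. *)
  rewrite fapply_mat_mode fapply_pythagoras // -CE.
  have -> : count id (fmask (fcat F1 (FMat U F2))) =
            (count id (fmask (fcat F1 (FSkip n F2)))).+1.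
    by rewrite !fmask_cat !count_cat /= add0n add1n addnS.
  rewrite -natr1 mulrDl mul1r; apply: lerD => //.
  have unfoldK r' n' u' (X : 'M[R]_(n', r' * u')) :
      unfold_free (fold_free X) = X.
    by apply/matrixP => i k; rewrite mxE ffunE mxE unfuseK.
  (* The new error is a train with the projection residual of [G] at the canonical site. *)
  rewrite -tt_tensor_mode unfoldK tt_tensorB dot_tt_tensor // -dot_mx.
  apply: dot_le_frobenius; move: errU; congr (mxnorm _ <= _).
  by apply/matrixP => i k; rewrite !mxE !ffunE !mxE unfuseK.
Qed.

(** Induction over the layers, with Pythagoras used twice in each: for the disentanglers, then for
    the isometries. *)
Lemma meracle_error K delta d (t : train R 1 1 d) (M : mera R K d) :
  meracle delta t M ->
  dot (tt_tensor t - mera_tensor M) (tt_tensor t - mera_tensor M) <=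
  (num_isometries M)%:R * delta ^+ 2.
Proof.
elim=> {d t M} [d t|d e f d' P Q B W hPB hQW t t2 t1 t1' t3 t4 M] /=.
  by rewrite subrr mul0r /dot big1 // => i _; rewrite ffunE mulr0.
move=> /supercores_tensor-> /(sweep_error full_svd_admissible)[oQ t1'E errQ].
move=> /svd_split_tensor t2E /supercores_tensor t3E.
move=> /(sweep_error (@trunc_svd_admissible _))[oW t4E errW] _ IH.
rewrite dot_tunreshape ftrK fapply_pythagoras // -t1'E natrD mulrDl.
(* The sweep with full SVDs has tolerance 0, so the disentanglers contribute no error. *)
rewrite -[leRHS]add0r; apply: lerD; first by rewrite expr0n mulr0 in errQ.
(* The remaining error is carried from the pairs of [P] over single indices to the groups of [B];
   reshaping preserves its norm. *)
rewrite -[tt_tensor t1'](tunreshapeK P) -t2E -(dot_tunreshape P) !treshapeK.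
rewrite t3E dot_tunreshape fapply_pythagoras // -t4E.
(* The isometries of this layer are charged to [errW], those of the later layers to [IH]. *)
exact: lerD.
Qed.

End Theory.

Theorem mainTheorem3 (R : rcfType) (K N : nat) (I : seq nat)
    (A : tensor R I) (t : train R 1 1 I) (eps : R) (M : mera R K I) :
  (2 <= K)%N ->
  tt_tensor t = A ->
  mixed_canonical K.-1 t ->
  0 <= eps ->
  num_isometries M = N ->
  meracle (eps * tnorm A / Num.sqrt N%:R) t M ->
  tnorm (A - mera_tensor M) <= eps * tnorm A.
Proof.
move=> _ tA _ eps_ge0 NE /meracle_error; rewrite tA NE => err.
have epsA_ge0 : 0 <= eps * tnorm A by rewrite mulr_ge0 ?frobenius_ge0.
(* The nonnegative bound is written as the root of its square, which reduces the claim to squared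
   norms. *)
rewrite /tnorm frobeniusE -[leRHS]ger0_norm // -sqrtr_sqr ler_wsqrtr //.
apply: le_trans err _; rewrite expr_div_n sqr_sqrtr ?ler0n //.
(* For [N = 0], [/ Num.sqrt 0] is [0] in MathComp: the tolerance is [0]. *)
case: (posnP N) => [->|N_gt0]; first by rewrite mul0r sqr_ge0.
by rewrite mulrCA divff ?mulr1 // pnatr_eq0 -lt0n.
Qed.
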